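(* Let $\alpha\in(0,\frac12]$, $\kappa=(\frac12)^{2-\alpha}$, and let $Z$ be the limit process. For any $\beta<1/2$, almost surely, the paths of $Z$ are H\''older continuous with exponent $\beta$ with respect to $d_\kappa$. For any $\beta>1/2$, almost surely, the paths of $Z$ are nowhere pointwise H\''older continuous with exponent $\beta$ with respect to $d_\kappa$.
   Context: Binary expansions: each $t\in[0,1)$ is written in binary as $t=\sum_{i\ge1}t_i2^{-i}$, $t_i\in\{0,1\}$, using the expansion in which $t_i=0$ for infinitely many $i$; and $1=\sum_{i\ge 1}2^{-i}$. For $u,v\in[0,1]$, $j(u,v):=\max\{j\ge1:(u_1,\dots,u_j)=(v_1,\dots,v_j)\}$ with $\max\emptyset:=0$, $\max\mathbb{N}:=\infty$. The metric $d_\kappa$ on $[0,1]$ is $d_\kappa(x,y):=\kappa^{j(x,y)}$, with $\kappa^\infty:=0$. H\''older exponents $\beta$ are positive. A function $f:[0,1]\to\mathbb{R}$ is pointwise H\''older continuous at $t$ with exponent $\beta$ with respect to $d_\kappa$ if there are $M,\varepsilon>0$ with $|f(s)-f(t)|\le M d_\kappa(s,t)^\beta$ for all $s\in[0,1]$ with $d_\kappa(s,t)<\varepsilon$; ''nowhere'' means at no $t\in[0,1]$. Limit process: let $\Theta:=\bigcup_{k\ge0}\{0,1\}^k$ be the set of finite $0$-$1$ words, $|\vartheta|$ the length of $\vartheta$, and $B_\vartheta\subset[0,1]$ the set of numbers whose binary expansion has prefix $\vartheta$. Let $\{N_\vartheta:\vartheta\in\Theta\}$ be independent standard normal random variables and,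 for $n\ge0$, $t\in[0,1]$, $$Z_n(t):=\sum_{\vartheta\in\Theta:\,|\vartheta|<n}\left(\tfrac12\right)^{(1-\alpha/2)|\vartheta|}\left(\mathbf{1}_{\{t\in B_{\vartheta0}\}}-\mathbf{1}_{\{t\in B_{\vartheta1}\}}\right)N_\vartheta .$$ The limit process $Z$ is the almost sure uniform limit of $(Z_n)_{n\ge0}$ on $[0,1]$ (this limit exists). *)

(* Defs.v *)
From HB Require Import structures.
From mathcomp Require Import all_boot all_order all_algebra.
From mathcomp Require Import all_classical all_reals all_analysis.
Set Implicit Arguments.
Unset Strict Implicit.
Unset Printing Implicit Defensive.
Import Order.TTheory GRing.Theory Num.Theory.
Import numFieldNormedType.Exports.
Local Open Scope classical_set_scope.
Local Open Scope ring_scope.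

(* Digit sequences are indexed from 0: [b i] is the coefficient of 2^-(i+1). *)
Definition is_binary_expansion (R : realType) (t : R) (b : nat -> bool) : Prop :=
  series (fun i => (b i)%:R * 2^-1 ^+ i.+1 : R) @ \oo --> t /\
  (t < 1 -> infinite_set [set i | b i = false]).

(* Meaningful for t in [0, 1] only, where the expansion exists and is unique
   (for t = 1 it is constantly true). *)
Definition binary_digits (R : realType) (t : R) : nat -> bool :=
  xget (fun=> false) [set b | is_binary_expansion t b].

(* The lengths j >= 1 of the common prefixes of the expansions of u and v. *)
Definition common_prefix_lengths (R : realType) (u v : R) : set nat :=
  [set j | (0 < j)%N /\
     forall i, (i < j)%N -> binary_digits u i = binary_digits v i].

(* Maximum of a set of naturals; [None] stands for infinity, the value on
   unbounded sets, and the empty set has maximum 0. *)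
Definition nat_max (A : set nat) : option nat :=
  if `[< exists m, forall n, A n -> (n <= m)%N >]
  then Some (xget 0%N [set m | A m /\ forall n, A n -> (n <= m)%N])
  else None.

Definition jdepth (R : realType) (u v : R) : option nat :=
  nat_max (common_prefix_lengths u v).

Definition dkappa (R : realType) (kappa x y : R) : R :=
  if jdepth x y is Some j then kappa ^+ j else 0.

Definition holder_continuous (R : realType) (kappa beta : R) (f : R -> R) : Prop :=
  exists2 M : R, 0 < M & forall s t : R, s \in `[0, 1] -> t \in `[0, 1] ->
    `|f s - f t| <= M * dkappa kappa s t `^ beta.

Definition pointwise_holder_at (R : realType) (kappa beta : R) (f : R -> R)
    (t : R) : Prop :=
  exists M eps : R, [/\ 0 < M, 0 < eps &
    forall s : R, s \in `[0, 1] -> dkappa kappa s t < eps ->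
      `|f s - f t| <= M * dkappa kappa s t `^ beta].

Definition nowhere_pointwise_holder (R : realType) (kappa beta : R)
    (f : R -> R) : Prop :=
  forall t : R, t \in `[0, 1] -> ~ pointwise_holder_at kappa beta f t.

Definition cylinder (R : realType) (w : seq bool) : set R :=
  [set t | t \in `[0, 1] /\
     forall i, (i < size w)%N -> binary_digits t i = nth false w i].

(* Mutual independence of a family of real random variables: the product rule
   over every finite subfamily. *)
Definition independent_RVs d (T : measurableType d) (R : realType)
    (P : probability T R) (I : eqType) (X : I -> {RV P >-> R}) : Prop :=
  forall (J : seq I) (A : I -> set R), uniq J ->
    (forall i, measurable (A i)) ->
    P (\big[setI/setT]_(i <- J) (X i @^-1` A i)) =
    (\prod_(i <- J) P (X i @^-1` A i))%E.

Definition standard_normal d (T : measurableType d) (R : realType)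
    (P : probability T R) (X : {RV P >-> R}) : Prop :=
  forall A : set R, measurable A -> distribution P X A = normal_prob 0 1 A.

Definition Zn d (T : measurableType d) (R : realType) (P : probability T R)
    (alpha : R) (N : seq bool -> {RV P >-> R}) (n : nat) (omega : T) (t : R) : R :=
  \sum_(k < n) \sum_(w : k.-tuple bool)
    2^-1 `^ ((1 - alpha / 2) * k%:R) *
    (\1_(cylinder (rcons w false)) t - \1_(cylinder (rcons w true)) t) *
    N w omega.

Definition is_limit_process d (T : measurableType d) (R : realType)
    (P : probability T R) (alpha : R) (N : seq bool -> {RV P >-> R})
    (Z : T -> R -> R) : Prop :=
  {ae P, forall omega,
    {uniform `[0, 1], (fun n => Zn alpha N n omega) @ \oo --> Z omega}}.

(* Main.v *)
(* Put [r = sqrt kappa], so that on [0, 1] the value of [Zn] at [t] is the sum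
   over [k < n] of [+- r^k N(t|k)], where [t|k] is the word of the first [k]
   digits of [t].
   For [beta < 1/2], Borel-Cantelli and the Gaussian tail give
   [|N_w| <= C rho^|w|] with [rho = kappa^(beta - 1/2) > 1]; two points with
   a common prefix of length [j] then differ in [Z] by a geometric tail of
   order [(r rho)^j = (kappa^j)^beta].
   For [beta > 1/2], assume [Z] is Hölder at [t]. Choosing the digits after the
   [n]th one greedily yields points near [t] at which all later increments have
   a prescribed sign, so the oscillation of [Z] on the cylinder of [t|n] is at
   least [2 r^n |N(t|n)|]. Hence [|N(t|n)| <= M kappa^(n (beta - 1/2))], which
   is eventually below 1/4. A given branch of length [m] with this property from
   level [n0] on has probability at most [4^(n0 - m)] and there are [2^m]
   branches, so almost surely no such [t] exists. *)
Require Import Defs.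
From mathcomp Require Import all_boot all_order all_algebra.
From mathcomp Require Import all_classical all_reals all_analysis.
From mathcomp Require Import measurable_realfun ring lra.
Import Order.TTheory GRing.Theory Num.Theory.
Import numFieldNormedType.Exports.
Local Open Scope classical_set_scope.
Local Open Scope ring_scope.
Set Implicit Arguments.
Unset Strict Implicit.
Unset Printing Implicit Defensive.

(** * Existence and uniqueness of binary expansions *)

Lemma finite_nat_ubound (A : set nat) : finite_set A ->
  exists m, forall n, A n -> (n <= m)%N.
Proof.
move=> /finite_seqP[s ->]; exists (\max_(i <- s) i)%N => n ns.
exact: (@leq_bigmax_seq _ s xpredT id).
Qed.

Definition binary_term (R : realType) (b : nat -> bool) (i : nat) : R :=
  (b i)%:R * 2^-1 ^+ i.+1.

Lemma binary_partial_sum_le (R : realType) (b : nat -> bool) (t : R) (n : nat) :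
  series (binary_term R b) @ \oo --> t -> series (binary_term R b) n <= t.
Proof.
move=> bt; rewrite -(cvg_lim (@Rhausdorff R) bt).
apply: nondecreasing_cvgn_le; last by apply/cvg_ex; exists t.
apply/nondecreasing_seqP => k; rewrite -subr_ge0 seriesSB /binary_term.
by rewrite mulr_ge0// exprn_ge0// invr_ge0.
Qed.

(** The sum plus [2^-1 ^+ n] is the right endpoint of the dyadic interval fixed by the first [n]
    digits: a digit 1 keeps it, a digit 0 lowers it. *)
Lemma binary_tail_nonincreasing (R : realType) (b : nat -> bool) :
  nonincreasing_seq (fun n => series (binary_term R b) n + 2^-1 ^+ n).
Proof.
apply/nonincreasing_seqP => k; rewrite seriesSr /binary_term -addrA lerD2l.
have h0 : 0 <= 2^-1 ^+ k :> R by rewrite exprn_ge0// invr_ge0.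
by rewrite exprS; case: (b k) => /=; rewrite ?mulr0n ?mulr1n; lra.
Qed.

Lemma le_binary_partial_sum (R : realType) (b : nat -> bool) (t : R) (n : nat) :
  series (binary_term R b) @ \oo --> t ->
  t <= series (binary_term R b) n + 2^-1 ^+ n.
Proof.
move=> bt.
have half : (fun n => 2^-1 ^+ n : R) @ \oo --> (0 : R).
  by apply: cvg_expr; rewrite ger0_norm ?invr_ge0// invf_lt1// ltr1n.
have bt' : (fun n => series (binary_term R b) n + 2^-1 ^+ n) @ \oo --> t.
  by rewrite -[X in _ --> X]addr0; exact: cvgD.
rewrite -(cvg_lim (@Rhausdorff R) bt').
apply: (nonincreasing_cvgn_ge (@binary_tail_nonincreasing R b)).
by apply/cvg_ex; exists t.
Qed.

Lemma lt_binary_partial_sum (R : realType) (b : nat -> bool) (t : R) (n k : nat) :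
  series (binary_term R b) @ \oo --> t -> (n <= k)%N -> b k = false ->
  t < series (binary_term R b) n + 2^-1 ^+ n.
Proof.
move=> bt nk bk; apply: lt_le_trans (@binary_tail_nonincreasing R b _ _ nk).
apply: le_lt_trans (le_binary_partial_sum k.+1 bt) _.
rewrite seriesSr {2}/binary_term bk mul0r addr0 ltrD2l exprS.
have h0 : 0 < 2^-1 ^+ k :> R by rewrite exprn_gt0// invr_gt0.
by lra.
Qed.

(** At the first disagreement, the sequence with digit 1 puts [t] at or above the dyadic midpoint,
    while the one with digit 0 has a later zero and puts [t] strictly below it. *)
Lemma binary_expansion_unique (R : realType) (t : R) (b b' : nat -> bool) :
  t < 1 -> is_binary_expansion t b -> is_binary_expansion t b' -> b = b'.
Proof.
move=> t1; suff main (c c' : nat -> bool) i : is_binary_expansion t c ->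
    is_binary_expansion t c' -> (forall j, (j < i)%N -> c j = c' j) ->
    c i -> c' i.
  move=> eb eb'; apply/funext => i.
  have [n] := ubnP i; elim: n i => // n IH i; rewrite ltnS => ilen.
  have bb' j : (j < i)%N -> b j = b' j.
    by move=> ji; apply: IH; exact: leq_trans ilen.
  apply/idP/idP; apply: main => // j ji.
  by rewrite bb'.
move=> [ct _] [ct' /(_ t1) inf] cc' ci; apply/negP => /negP/negbTE c'i.
have [k [ik c'k]] : exists k, (i < k)%N /\ c' k = false.
  apply: contrapT => nok; apply: inf; apply: (@sub_finite_set _ _ `I_i.+1).
    move=> k /= c'k; rewrite ltnS leqNgt; apply/negP => ik.
    by apply: nok; exists k.
  exact: finite_II.
have := lt_binary_partial_sum ct' ik c'k.
have := binary_partial_sum_le i.+1 ct.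
rewrite !seriesSr {2 4}/binary_term ci c'i mul0r addr0 mul1r => h1 h2.
have := le_lt_trans h1 h2; rewrite ltrD2r !seriesEord /=.
rewrite (eq_bigr (fun j : 'I_i => binary_term R c' j)) ?ltxx//.
by move=> j _; rewrite /binary_term cc'.
Qed.

(** Orbit of the map x -> 2x mod 1; a binary digit of [t] tells whether the corresponding orbit
    point lies in [1/2, 1). *)
Fixpoint doubling_orbit (R : realType) (t : R) (n : nat) : R :=
  if n is m.+1 then
    let x := doubling_orbit t m in 2 * x - (2^-1 <= x)%R%:R
  else t.

Lemma doubling_orbit_itv (R : realType) (t : R) (n : nat) :
  0 <= t < 1 -> 0 <= doubling_orbit t n < 1.
Proof.
move=> t01; elim: n => //= n /andP[x0 x1].
case: (lerP 2^-1 (doubling_orbit t n)) => hx; rewrite ?mulr0n ?mulr1n;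
  by apply/andP; split; lra.
Qed.

Lemma binary_expansion_exists_lt1 (R : realType) (t : R) : 0 <= t < 1 ->
  exists b, is_binary_expansion t b.
Proof.
move=> t01; pose x := doubling_orbit t; pose b i := (2^-1 <= x i)%R.
have x01 n := doubling_orbit_itv n t01.
have xS n : x n.+1 = 2 * x n - (b n)%:R by [].
(* The remainder is the rescaled orbit point, so it tends to 0. *)
have sumE n : series (binary_term R b) n = t - x n * 2^-1 ^+ n.
  elim: n => [|n IH]; first by rewrite seriesEord/= big_ord0 expr0 mulr1 subrr.
  by rewrite seriesSr IH /binary_term xS exprS; field.
exists b; split.
  rewrite (_ : series _ = fun n => t - x n * 2^-1 ^+ n); last exact/funext.
  rewrite -[X in _ --> X]subr0; apply: cvgB; first exact: cvg_cst.
  apply: (@squeeze_cvgr _ _ _ _ (fun=> 0) (fun n => 2^-1 ^+ n)).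
  - near=> n; have /andP[x0 x1] := x01 n.
    have h0 : 0 <= 2^-1 ^+ n :> R by rewrite exprn_ge0// invr_ge0.
    by rewrite mulr_ge0//= ler_piMl// ltW.
  - exact: cvg_cst.
  - by apply: cvg_expr; rewrite ger0_norm ?invr_ge0// invf_lt1// ltr1n.
move=> _ fin.
have [n0 hn0] : exists n0, forall n, (n0 <= n)%N -> b n.
  have [m hm] := finite_nat_ubound fin.
  exists m.+1 => n mn; apply: contrapT => /negP/negbTE bn.
  by have := hm n bn; rewrite leqNgt mn.
(* With digit 1 forever, the gap [1 - x n] doubles at each step. *)
have gap k : 1 - x (n0 + k)%N = 2 ^+ k * (1 - x n0).
  elim: k => [|k IH]; first by rewrite addn0 expr0 mul1r.
  by rewrite addnS xS hn0 ?leq_addr//= exprS -mulrA -IH mulr1n; ring.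
have /andP[_ xn0] := x01 n0.
have pos : 0 < 1 - x n0 by rewrite subr_gt0.
(* Enough doublings push the gap above 1, which contradicts the nonnegativity of the orbit. *)
have [k hk] : exists k, (1 - x n0)^-1 < 2 ^+ k.
  exists (Num.truncn (1 - x n0)^-1).+1.
  apply: (lt_le_trans (truncnS_gt _)).
  by rewrite -natrX ler_nat ltnW// ltn_expl.
have := gap k; have /andP[xk0 _] := x01 (n0 + k)%N.
have : 1 < 2 ^+ k * (1 - x n0) by rewrite -ltr_pdivrMr// mul1r.
rewrite -/x in xk0; lra.
Unshelve. all: by end_near. Qed.

Lemma binary_expansion1 (R : realType) : is_binary_expansion (1 : R) (fun=> true).
Proof.
split; last by rewrite ltxx.
rewrite (_ : series _ = fun n => 1 - 2^-1 ^+ n :> R).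
  rewrite -[X in _ --> X]subr0; apply: cvgB; first exact: cvg_cst.
  by apply: cvg_expr; rewrite ger0_norm ?invr_ge0// invf_lt1// ltr1n.
apply/funext; elim=> [|n IH]; first by rewrite seriesEord/= big_ord0 expr0 subrr.
by rewrite seriesSr IH /binary_term exprS /= mulr1n; field.
Qed.

(** An expansion exists on [0, 1], so [xget] never falls back on its default there. *)
Lemma binary_digitsP (R : realType) (t : R) : t \in `[0, 1] ->
  is_binary_expansion t (binary_digits t).
Proof.
rewrite in_itv /= => /andP[t0]; rewrite le_eqVlt => /orP[/eqP ->|t1].
  exact: (xgetPex _ (ex_intro _ _ (binary_expansion1 R))).
apply: (xgetPex (fun=> false)).
by apply: binary_expansion_exists_lt1; rewrite t0 t1.
Qed.

Lemma binary_digits_inj (R : realType) (s t : R) : s \in `[0, 1] ->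
  t \in `[0, 1] -> binary_digits s = binary_digits t -> s = t.
Proof.
move=> /binary_digitsP[sP _] /binary_digitsP[tP _] st.
by move: sP; rewrite st => /(cvg_lim (@Rhausdorff R)) <-; exact: cvg_lim tP.
Qed.

(** Sequences ending in zeros respect the convention of infinitely many zeros, so they are digits of
    actual points; these serve as test points for the lower bound on oscillations. *)
Lemma binary_digits_finite_surj (R : realType) (b : nat -> bool) (n : nat) :
  (forall i, (n <= i)%N -> b i = false) ->
  exists2 t : R, t \in `[0, 1] & binary_digits t = b.
Proof.
move=> b0; pose t : R := series (binary_term R b) n.
have bt : series (binary_term R b) @ \oo --> t.
  apply: cvg_near_cst.
  exists n => // m /= nm; rewrite /t -(subnKC nm).
  elim: (m - n)%N => [|k IH]; first by rewrite addn0.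
  by rewrite addnS seriesSr IH /binary_term b0 ?leq_addr// mul0r addr0.
have t0 : 0 <= t.
  by have := binary_partial_sum_le 0 bt; rewrite seriesEord/= big_ord0.
have t1 : t < 1.
  have := lt_binary_partial_sum bt (leq0n n) (b0 n (leqnn n)).
  by rewrite seriesEord/= big_ord0 add0r expr0.
have t01 : t \in `[0, 1] by rewrite in_itv/= t0 ltW.
exists t => //; apply: (binary_expansion_unique t1 (binary_digitsP t01)).
split=> // _ fin; have [m hm] := finite_nat_ubound fin.
have := hm (maxn n m.+1); rewrite /= b0 ?leq_maxl// => /(_ erefl).
by rewrite leqNgt leq_max ltnSn orbT.
Qed.

(** * Common prefixes and the metric [dkappa] *)

(** A bounded nonempty set of naturals has a maximum, so the default 0 of [xget] is reached only for
    the empty set. *)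
Lemma nat_max_SomeP (A : set nat) (m : nat) : nat_max A = Some m ->
  (A m \/ m = 0%N) /\ forall n, A n -> (n <= m)%N.
Proof.
rewrite /nat_max; case: asboolP => // -[k kA] [].
case: xgetP => [x _ [Ax xmax] <-|nomax <-]; first by split; [left|].
split; first by right.
move=> n An; exfalso; pose p i := `[< A i >].
have exp : exists i, p i by exists n; exact/asboolP.
have ubp i : p i -> (i <= k)%N by move=> /asboolP; exact: kA.
case: (ex_maxnP exp ubp) => i /asboolP Ai imax.
by apply: (nomax i); split=> // j Aj; apply/imax/asboolP.
Qed.

Lemma nat_max_bounded (A : set nat) (k : nat) :
  (forall n, A n -> (n <= k)%N) -> exists m, nat_max A = Some m.
Proof. by move=> kA; rewrite /nat_max asboolT; [eexists|exists k]. Qed.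

Lemma dkappa_le (R : realType) (kappa s t : R) (n : nat) : 0 <= kappa <= 1 ->
  (forall i, (i < n)%N -> binary_digits s i = binary_digits t i) ->
  dkappa kappa s t <= kappa ^+ n.
Proof.
move=> /andP[k0 k1] st; rewrite /dkappa /jdepth.
case jE : (nat_max _) => [j|]; last exact: exprn_ge0.
have [_ jmax] := nat_max_SomeP jE.
apply: ler_wiXn2l => //.
(* The set contains only positive lengths, so [n = 0] is treated apart. *)
by case: n st => // n st; apply: jmax; split.
Qed.

Lemma dkappa_ge0 (R : realType) (kappa s t : R) : 0 <= kappa ->
  0 <= dkappa kappa s t.
Proof. by rewrite /dkappa; case: jdepth => // j k0; exact: exprn_ge0. Qed.

(** A differing digit bounds all common prefix lengths, hence the depth is a finite [j]; at [j = 0]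
    the agreement is vacuous. *)
Lemma dkappa_neq (R : realType) (kappa s t : R) :
  s \in `[0, 1] -> t \in `[0, 1] -> s != t ->
  exists2 j, dkappa kappa s t = kappa ^+ j &
    forall i, (i < j)%N -> binary_digits s i = binary_digits t i.
Proof.
move=> s01 t01 /eqP st.
have [i ist] : exists i, binary_digits s i <> binary_digits t i.
  apply: contrapT => noi; apply/st/binary_digits_inj => //; apply/funext => i.
  by apply: contrapT => ist; apply: noi; exists i.
have [j jE] : exists j, jdepth s t = Some j.
  apply: (@nat_max_bounded _ i) => n [_ agree].
  by rewrite leqNgt; apply/negP => /agree.
exists j; first by rewrite /dkappa jE.
by have [[[_]|->]] := nat_max_SomeP jE.
Qed.

(** * Estimates for the standard normal law *)

Lemma set_norm_leE (R : realType) (a : R) :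
  [set x : R | `|x| <= a] = `[- a, a]%classic.
Proof. by apply/seteqP; split => x /=; rewrite in_itv/= ler_norml. Qed.

Lemma measurable_norm_le (R : realType) (a : R) :
  measurable [set x : R | `|x| <= a].
Proof. by rewrite set_norm_leE. Qed.

Lemma measurable_norm_gt (R : realType) (a : R) :
  measurable [set x : R | a < `|x|].
Proof.
rewrite (_ : mkset _ = ~` [set x : R | `|x| <= a]).
  by apply: measurableC; exact: measurable_norm_le.
by apply/seteqP; split => x /=; rewrite ltNge => /negP.
Qed.

(* The standard density is compared with the centered one of deviation 2:
   [phi_1 x = 2 * phi_2 x * exp (-3 x^2 / 8)]. *)
Lemma normal_prob_tail (R : realType) (a : R) : 0 <= a ->
  (normal_prob 0 1 [set x : R | (a < `|x|)%R] <=
    (2 * expR (- (3 / 8 * a ^+ 2)))%:E)%E.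
Proof.
move=> a0.
have mA := measurable_norm_gt a.
set c := 2 * _.
have c0 : 0 <= c by rewrite mulr_ge0// expR_ge0.
apply: (@le_trans _ _ (\int[lebesgue_measure]_(x in [set x : R | (a < `|x|)%R])
    (c%:E * (normal_pdf 0 2 x)%:E))%E).
  apply: ge0_le_integral => //.
  - by move=> x _; rewrite lee_fin normal_pdf_ge0.
  - by apply/measurable_funTS/measurable_EFinP; exact: measurable_normal_pdf.
  - apply: measurable_funeM; apply/measurable_funTS/measurable_EFinP.
    exact: measurable_normal_pdf.
  move=> x /= ax; rewrite -EFinM lee_fin !normal_pdfE ?oner_eq0 ?pnatr_eq0//.
  rewrite /normal_fun subr0.
  have -> : normal_peak (2 : R) = 2^-1 * normal_peak 1.
    rewrite /normal_peak -invfM; congr (_ ^-1).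
    rewrite expr1n mul1r -mulrnAr sqrtrM ?sqr_ge0// sqrtr_sqr ger0_norm//.
  have -> : - x ^+ 2 / (1 ^+ 2 *+ 2) =
      - (3 / 8 * x ^+ 2) + - x ^+ 2 / (2 ^+ 2 *+ 2) :> R.
    by rewrite expr1n !mulr2n; field.
  have -> : c * (2^-1 * normal_peak 1 * expR (- x ^+ 2 / (2 ^+ 2 *+ 2))) =
      normal_peak 1 * (expR (- (3 / 8 * a ^+ 2)) *
        expR (- x ^+ 2 / (2 ^+ 2 *+ 2))) by rewrite /c; field.
  rewrite expRD ler_wpM2l ?normal_peak_ge0// ler_wpM2r ?expR_ge0// ler_expR.
  rewrite lerN2 ler_wpM2l// -(real_normK (num_real x)).
  by rewrite lerXn2r ?nnegrE// ltW.
rewrite ge0_integralZl//; last 2 first.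
  by apply/measurable_funTS/measurable_EFinP; exact: measurable_normal_pdf.
  by move=> x _; rewrite lee_fin normal_pdf_ge0.
rewrite -[leRHS]mule1 lee_wpmul2l// -(integral_normal_pdf 0 (2 : R)).
apply: ge0_subset_integral => //.
  by apply/measurable_EFinP; exact: measurable_normal_pdf.
by move=> x _; rewrite lee_fin normal_pdf_ge0.
Qed.

(** The density is at most 1/sqrt(2 pi) <= 1/2 and the interval has length 1/2. *)
Lemma normal_prob_center (R : realType) :
  (normal_prob 0 1 [set x : R | (`|x| <= 4^-1)%R] <= 4^-1%:E)%E.
Proof.
rewrite set_norm_leE.
have peak : normal_peak (1 : R) <= 2^-1.
  rewrite /normal_peak lef_pV2 ?posrE ?sqrtr_gt0//; last first.
    by rewrite expr1n mul1r mulrn_wgt0// pi_gt0.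
  rewrite -[leLHS]ger0_norm// -sqrtr_sqr ler_wsqrtr//.
  by have := pi_ge2 R; rewrite expr1n mul1r mulr2n expr2; lra.
apply: (@le_trans _ _
    (\int[lebesgue_measure]_(x in `[(- 4^-1)%R, (4^-1)%R]) (2^-1 : R)%:E)%E).
  apply: ge0_le_integral => //.
  - by move=> x _; rewrite lee_fin normal_pdf_ge0.
  - by apply/measurable_funTS/measurable_EFinP; exact: measurable_normal_pdf.
  - move=> x _; rewrite lee_fin (le_trans _ peak)//.
    by rewrite normal_pdf_ub// oner_eq0.
rewrite integral_cst//= lebesgue_measure_itv/= lte_fin ifT; last by lra.
by rewrite -EFinB -EFinM lee_fin; lra.
Qed.

Lemma bernoulli_ineq (R : realFieldType) (x : R) (n : nat) : 0 <= x ->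
  1 + n%:R * x <= (1 + x) ^+ n.
Proof.
move=> x0; elim: n => [|n IH]; first by rewrite expr0 mul0r addr0.
rewrite exprS; apply: (@le_trans _ _ ((1 + x) * (1 + n%:R * x))).
  have n0 : 0 <= n%:R :> R by [].
  by rewrite -natr1; nra.
by rewrite ler_wpM2l// addr_ge0.
Qed.

(** With [e = rho - 1], Bernoulli gives rho^(2k) >= (k e)^2 >= 8k for large [k], so the tail bound
    is at most 2 exp(-3k) <= 2 / 4^k, small enough to sum over the [2 ^+ k] words of level [k]. *)
Lemma normal_tail_geometric (R : realType) (rho : R) : 1 < rho ->
  exists K, forall k, (K <= k)%N ->
    2 ^+ k * (2 * expR (- (3 / 8 * (rho ^+ k) ^+ 2))) <= 4 / 2 ^+ k.+1.
Proof.
move=> rho1; pose e := rho - 1.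
have e0 : 0 < e by rewrite subr_gt0.
exists (Num.truncn (8 / e ^+ 2)).+1 => k Kk.
have k8 : 8 <= k%:R * e ^+ 2.
  rewrite -ler_pdivrMr ?exprn_gt0//; apply: le_trans (ltW (truncnS_gt _)) _.
  by rewrite ler_nat.
have rk : 8 * k%:R <= (rho ^+ k) ^+ 2.
  have := bernoulli_ineq k (ltW e0); have -> : 1 + e = rho by rewrite addrC subrK.
  move=> ek.
  have k0 : 0 <= k%:R :> R by [].
  apply: (@le_trans _ _ ((k%:R * e) ^+ 2)); first by rewrite exprMn expr2; nra.
  have rho0 : 0 <= rho by rewrite ltW// (lt_trans _ rho1).
  rewrite lerXn2r ?nnegrE ?exprn_ge0 ?mulr_ge0 ?(ltW e0)//.
  by apply: le_trans ek; rewrite lerDr.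
have : expR (- (3 / 8 * (rho ^+ k) ^+ 2)) <= (4 ^+ k)^-1 :> R.
  rewrite expRN lef_pV2 ?posrE ?exprn_gt0 ?expR_gt0//.
  apply: (@le_trans _ _ (expR 3 ^+ k)).
    by rewrite lerXn2r ?nnegrE ?expR_ge0//; have := expR_ge1Dx (3 : R); lra.
  by rewrite -expRM_natl ler_expR; lra.
move=> h; apply: (@le_trans _ _ (2 ^+ k * (2 * (4 ^+ k)^-1))).
  by rewrite ler_wpM2l ?exprn_ge0// ler_wpM2l.
have -> : 4 ^+ k = 2 ^+ k * 2 ^+ k :> R by rewrite -exprMn; congr (_ ^+ _); lra.
have u : 2 ^+ k != 0 :> R by rewrite expf_neq0.
by rewrite exprS le_eqVlt; apply/orP; left; apply/eqP; field.
Qed.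

(** * Almost sure bounds along the binary tree *)

Lemma measure_bigsetU_le d (T : measurableType d) (R : realType)
    (mu : {measure set T -> \bar R}) (I : Type) (s : seq I) (F : I -> set T) :
  (forall i, measurable (F i)) ->
  (mu (\big[setU/set0]_(i <- s) F i) <= \sum_(i <- s) mu (F i))%E.
Proof.
move=> mF; elim: s => [|i s IH]; first by rewrite !big_nil measure0.
rewrite !big_cons; apply: le_trans (measureU2 _ _ _) _ => //.
  by apply: bigsetU_measurable => j _; exact: mF.
by rewrite leeD2l.
Qed.

Lemma probability_level_union_le d (T : measurableType d) (R : realType)
    (P : probability T R) (F : seq bool -> set T) (m : nat) (c : R) :
  (forall w, measurable (F w)) ->
  (forall w : m.-tuple bool, (P (F w) <= c%:E)%E) ->
  (P (\big[setU/set0]_(w : m.-tuple bool) F w) <= (2 ^+ m * c)%:E)%E.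
Proof.
move=> mF Fc; apply: le_trans (measure_bigsetU_le _ _ _) _ => //.
apply: (@le_trans _ _ (\sum_(w : m.-tuple bool) c%:E)%E).
  by apply: lee_sum => w _; exact: Fc.
by rewrite sumEFin sumr_const card_tuple card_bool lee_fin -[c *+ _]mulr_natl natrX.
Qed.

(** Borel-Cantelli over the levels: almost surely only finitely many levels contain a word exceeding
    [rho ^+ size w], and the constant [C] absorbs them. *)
Lemma ae_words_growth d (T : measurableType d) (R : realType)
    (P : probability T R) (N : seq bool -> {RV P >-> R}) (rho : R) :
  (forall w, standard_normal (N w)) -> 1 < rho ->
  {ae P, forall omega, exists2 C, 0 < C &
    forall w, `|N w omega| <= C * rho ^+ size w}.
Proof.
move=> hN rho1; have rho0 : 0 <= rho by rewrite ltW// (lt_trans _ rho1).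
have [K tailK] := normal_tail_geometric rho1.
pose G k (w : seq bool) := N w @^-1` [set x | rho ^+ k < `|x|].
have mG k w : measurable (G k w).
  by apply: measurable_funPTI; exact: measurable_norm_gt.
(* The shift by [K] makes the tail bound available for every [k]. *)
pose F k := \big[setU/set0]_(w : (K + k).-tuple bool) G (K + k)%N w.
have mF k : measurable (F k) by exact: bigsetU_measurable.
have PF k : (P (F k) <= (4 / (2 ^ (k + 1))%:R)%:E)%E.
  have GP (w : (K + k).-tuple bool) : (P (G (K + k)%N w) <=
      (2 * expR (- (3 / 8 * (rho ^+ (K + k)) ^+ 2)))%:E)%E.
    have := hN w _ (measurable_norm_gt (rho ^+ (K + k))).
    rewrite /distribution /pushforward /= => ->.
    by apply: normal_prob_tail; rewrite exprn_ge0.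
  apply: le_trans (probability_level_union_le (mG _) GP) _.
  rewrite lee_fin; apply: le_trans (tailK _ (leq_addr _ _)) _.
  rewrite natrX ler_wpM2l// lef_pV2 ?posrE ?exprn_gt0// addn1.
  by rewrite ler_eXn2l ?ltr1n// ltnS leq_addl.
exists (lim_sup_set F); split.
- by apply: bigcapT_measurable => n; exact: bigcup_measurable.
- apply: lim_sup_set_cvg0 => //.
  apply: (@le_lt_trans _ _ (\sum_(k <oo) (4 / (2 ^ (k + 1))%:R)%:E)%E).
    by apply: lee_nneseries => [k _ _|k _]; [exact: measure_ge0|exact: PF].
  by rewrite (cvg_lim _ (@cvg_geometric_eseries_half R 4 0))// ltry.
move=> omega; apply: contra_notP => /existsNP[n].
(* [S] dominates the variables on the finitely many levels left uncontrolled. *)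
move=> noF; pose S : R := \sum_(k < K + n) \sum_(w : k.-tuple bool) `|N w omega|.
have S0 : 0 <= S by apply: sumr_ge0 => k _; exact: sumr_ge0.
exists (1 + S); first by rewrite ltr_pwDl.
move=> w; have rw1 : 1 <= rho ^+ size w by rewrite exprn_ege1// ltW.
have [szw|szw] := ltnP (size w) (K + n).
  apply: (@le_trans _ _ ((1 + S) * 1)); last by rewrite ler_wpM2l// addr_ge0.
  rewrite mulr1 -[leLHS]add0r lerD// /S (bigD1 (Ordinal szw))//=.
  rewrite (bigD1 (in_tuple w))//= -addrA lerDl addr_ge0//; first exact: sumr_ge0.
  by apply: sumr_ge0 => k _; exact: sumr_ge0.
apply: (@le_trans _ _ (rho ^+ size w)); last first.
  by rewrite ler_peMl ?exprn_ge0// lerDl.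
rewrite leNgt; apply/negP => big; apply: noF => _.
have Kw : (K <= size w)%N by apply: leq_trans szw; exact: leq_addr.
exists (size w - K)%N; first by rewrite /= leq_subRL.
rewrite /F subnKC// -bigcup_seq; exists (in_tuple w) => //=.
by rewrite mem_index_enum.
Qed.

Lemma prob_small_path_le d (T : measurableType d) (R : realType)
    (P : probability T R) (N : seq bool -> {RV P >-> R}) (n0 k : nat)
    (w : seq bool) :
  (forall w, standard_normal (N w)) -> independent_RVs N ->
  size w = (n0 + k)%N ->
  (P (\big[setI/setT]_(n <- iota n0 k)
      N (take n w) @^-1` [set x | (`|x| <= 4^-1)%R]) <= (4^-1 ^+ k)%:E)%E.
Proof.
move=> hN hI szw; pose J := [seq take n w | n <- iota n0 k].
(* Prefixes of different lengths are different words, so independence yields a product. *)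
have uJ : uniq J.
  rewrite map_inj_in_uniq ?iota_uniq// => i j.
  rewrite !mem_iota => /andP[_ ik] /andP[_ jk] /(congr1 size).
  by rewrite !size_takel// szw ltnW.
have mA := @measurable_norm_le R 4^-1.
have := hI J (fun=> [set x | `|x| <= 4^-1]) uJ (fun=> mA).
rewrite !big_map => ->.
have q w' : (P (N w' @^-1` [set x | (`|x| <= 4^-1)%R]) <= 4^-1%:E)%E.
  have := hN w' _ mA; rewrite /distribution /pushforward /= => ->.
  exact: normal_prob_center.
elim: k {szw J uJ} n0 => [|k IH] n0; first by rewrite big_nil.
rewrite big_cons exprS EFinM.
apply: lee_pmul; [exact: measure_ge0| |exact: q|exact: IH].
by apply: prode_ge0 => i _; exact: measure_ge0.
Qed.

(** Each [F k] involves finitely many prefixes, yet the null set [\bigcap_k F k] serves the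
    uncountably many branches at once. Its probability is at most 2^(n0 + k) / 4^k = 2^n0 / 2^k for
    every [k]. *)
Lemma ae_no_small_path d (T : measurableType d) (R : realType)
    (P : probability T R) (N : seq bool -> {RV P >-> R}) :
  (forall w, standard_normal (N w)) -> independent_RVs N ->
  {ae P, forall omega, forall n0 (b : nat -> bool),
    exists2 n, (n0 <= n)%N & 4^-1 < `|N (mkseq b n) omega|}.
Proof.
move=> hN hI.
apply: (ae_foralln (P := fun n0 omega => forall b : nat -> bool,
  exists2 n, (n0 <= n)%N & 4^-1 < `|N (mkseq b n) omega|)) => n0.
pose G k (w : seq bool) := \big[setI/setT]_(n <- iota n0 k)
  N (take n w) @^-1` [set x | `|x| <= 4^-1].
have mG k w : measurable (G k w).
  apply: bigsetI_measurable => n _; apply: measurable_funPTI.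
  exact: measurable_norm_le.
pose F k := \big[setU/set0]_(w : (n0 + k).-tuple bool) G k w.
have mF k : measurable (F k) by exact: bigsetU_measurable.
have PF k : (P (F k) <= (2 ^+ (n0 + k) * 4^-1 ^+ k)%:E)%E.
  apply: probability_level_union_le => // w.
  by apply: prob_small_path_le => //; rewrite size_tuple.
have mI : measurable (\bigcap_k F k) by exact: bigcapT_measurable.
have PI0 : P (\bigcap_k F k) = 0%E.
  have fI : P (\bigcap_k F k) \is a fin_num by exact: fin_num_measure.
  apply/eqP; rewrite eq_le measure_ge0 andbT -(fineK fI) lee_fin.
  have half : (fun k => 2 ^+ n0 * 2^-1 ^+ k : R) @ \oo --> (0 : R).
    rewrite -[X in _ --> X](mulr0 (2 ^+ n0)); apply: cvgMr.
    by apply: cvg_expr; rewrite ger0_norm ?invr_ge0// invf_lt1// ltr1n.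
  rewrite -(cvg_lim (@Rhausdorff R) half); apply: limr_ge.
    by apply/cvg_ex; exists 0.
  near=> k; rewrite -lee_fin fineK//.
  apply: (@le_trans _ _ (P (F k))).
    by apply: le_measure; rewrite ?inE//; exact: bigcap_inf.
  apply: le_trans (PF k) _; rewrite lee_fin exprD -mulrA -exprMn.
  by rewrite (_ : 2 * 4^-1 = 2^-1 :> R)//; lra.
exists (\bigcap_k F k); split => //.
move=> omega; apply: contra_notP => /existsNP[k noF] b.
(* If the branch [b] is small from level [n0] on, its prefix of length [n0 + k] places [omega] in
   [F k]. *)
apply: contrapT => small; apply: noF => _; rewrite /F -bigcup_seq.
have bk : size (mkseq b (n0 + k)) == (n0 + k)%N by rewrite size_mkseq.
exists (Tuple bk); first by rewrite /= mem_index_enum.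
rewrite /G -bigcap_seq => n /=; rewrite mem_iota => /andP[n0n nk].
rewrite /mkseq -map_take take_iota (minn_idPl (ltnW nk)).
by rewrite leNgt; apply/negP => big; apply: small; exists n.
Unshelve. all: by end_near. Qed.

(** * Partial sums as functions of digit sequences *)

(** Takes any digit sequence instead of a point, so that digits can be edited one at a time; [g]
    stands for the family [N] at a fixed [omega]. *)
Definition digit_sum (R : realType) (r : R) (g : seq bool -> R)
    (b : nat -> bool) (n : nat) : R :=
  \sum_(k < n) r ^+ k * ((-1) ^+ b k * g (mkseq b k)).

Lemma eq_mkseq_le (T : Type) (b b' : nat -> T) (n k : nat) : (k <= n)%N ->
  (forall i, (i < n)%N -> b i = b' i) -> mkseq b k = mkseq b' k.
Proof.
move=> kn bb'; apply/eq_in_map => i.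
by rewrite mem_iota => /andP[_ ik]; apply/bb'/(leq_trans ik).
Qed.

Lemma eq_digit_sum (R : realType) (r : R) (g : seq bool -> R)
    (b b' : nat -> bool) (n : nat) :
  (forall i, (i < n)%N -> b i = b' i) ->
  digit_sum r g b n = digit_sum r g b' n.
Proof.
move=> bb'; apply: eq_bigr => k _; rewrite bb'//.
by rewrite (eq_mkseq_le (ltnW (ltn_ord k)) bb').
Qed.

Lemma cylinder_rconsE (R : realType) (w : seq bool) (c : bool) (t : R) :
  t \in `[0, 1] ->
  \1_(cylinder (rcons w c)) t =
    ((w == mkseq (binary_digits t) (size w)) && (c == binary_digits t (size w)))%:R
    :> R.
Proof.
move=> t01; rewrite indicE; congr (_%:R); congr nat_of_bool.
apply/idP/idP => [|/andP[/eqP wE /eqP cE]].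
  rewrite inE => -[_]; rewrite size_rcons => dig.
  apply/andP; split; last by rewrite dig// nth_rcons ltnn eqxx.
  apply/eqP/(@eq_from_nth _ false); first by rewrite size_mkseq.
  by move=> i iw; rewrite nth_mkseq// dig ?(leqW iw)// nth_rcons iw.
rewrite inE; split=> // i; rewrite size_rcons ltnS leq_eqVlt nth_rcons.
by case/predU1P => [->|iw]; rewrite ?ltnn ?eqxx// iw wE nth_mkseq.
Qed.

(** At level [k] only the word of the first [k] digits of [t] contributes, and its two indicators
    combine into the sign given by the next digit. *)
Lemma ZnE d (T : measurableType d) (R : realType) (P : probability T R)
    (alpha : R) (N : seq bool -> {RV P >-> R}) (n : nat) (omega : T) (t : R) :
  t \in `[0, 1] ->
  Zn alpha N n omega t =
    digit_sum (2^-1 `^ (1 - alpha / 2)) (fun w => N w omega) (binary_digits t) n.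
Proof.
move=> t01; apply: eq_bigr => k _.
have bk : size (mkseq (binary_digits t) k) == k by rewrite size_mkseq.
rewrite (bigD1 (Tuple bk))//= big1 ?addr0 => [|w wb]; last first.
  rewrite !cylinder_rconsE// size_tuple.
  rewrite (_ : (w == _ :> seq bool) = false) ?subrr ?mulr0 ?mul0r//.
  by apply: contraNF wb => /eqP wE; apply/eqP/val_inj.
rewrite !cylinder_rconsE// size_mkseq eqxx /= powRrM powR_mulrn ?powR_ge0//.
rewrite -mulrA; congr (_ * (_ * _)).
by case: (binary_digits t k); rewrite /= ?sub0r ?subr0.
Qed.

(** The first [j] increments cancel and the others are dominated by a geometric series of ratio
    [gamma]. *)
Lemma digit_sum_diff_le (R : realType) (r gamma C : R) (g : seq bool -> R)
    (b b' : nat -> bool) (j n : nat) :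
  0 <= r -> 0 <= gamma < 1 -> 0 <= C ->
  (forall w, r ^+ size w * `|g w| <= C * gamma ^+ size w) ->
  (forall i, (i < j)%N -> b i = b' i) ->
  `|digit_sum r g b n - digit_sum r g b' n| <=
    2 * C / (1 - gamma) * gamma ^+ j.
Proof.
move=> r0 /andP[g0 g1] C0 gC bb'; set D := 2 * C / (1 - gamma).
have g1' : 0 < 1 - gamma by rewrite subr_gt0.
have D0 : 0 <= D by rewrite divr_ge0 ?mulr_ge0// ltW.
(* The exact finite geometric sum is what passes through the induction; [maxn] makes it vanish while
   [n <= j]. *)
suff main : `|digit_sum r g b n - digit_sum r g b' n| <=
    D * (gamma ^+ j - gamma ^+ maxn n j).
  by apply: (le_trans main); rewrite ler_wpM2l// gerBl exprn_ge0.
have term (c : nat -> bool) k :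
    `|r ^+ k * ((-1) ^+ c k * g (mkseq c k))| <= C * gamma ^+ k.
  rewrite normrM normrX normrMsign (ger0_norm r0).
  by have := gC (mkseq c k); rewrite size_mkseq.
elim: n => [|n IH].
  by rewrite /digit_sum !big_ord0 max0n !subrr normr0 mulr0.
rewrite /digit_sum !big_ord_recr /= opprD addrACA.
have [nj|jn] := ltnP n j.
  rewrite (maxn_idPr nj) bb'// (eq_mkseq_le (ltnW nj) bb') subrr addr0.
  by move: IH; rewrite (maxn_idPr (ltnW nj)).
move: IH; rewrite (maxn_idPl jn) (maxn_idPl (leqW jn)) => IH.
apply: le_trans (ler_normD _ _) _; apply: le_trans (lerD IH (ler_normB _ _)) _.
apply: le_trans (lerD (lexx _) (lerD (term b n) (term b' n))) _.
rewrite le_eqVlt; apply/orP; left; apply/eqP.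
by rewrite exprS /D; field; rewrite gt_eqF.
Qed.

(* The digits after [n] are chosen so that every later increment has sign
   [(-1) ^+ sg]; cutting off with zeros keeps the sequence the expansion of a
   real number. *)
Lemma greedy_digits (R : realType) (r : R) (g : seq bool -> R)
    (b0 : nat -> bool) (sg : bool) (n m : nat) : 0 <= r ->
  exists b : nat -> bool, [/\ forall i, (i < n)%N -> b i = b0 i,
    forall i, (n + m.+1 <= i)%N -> b i = false &
    r ^+ n * `|g (mkseq b0 n)| <=
      (-1) ^+ sg * (digit_sum r g b (n + m.+1) - digit_sum r g b0 n)].
Proof.
(* The digit at [k] turns [g] into [(-1) ^+ sg] times its absolute value; later digits are reset to
   0. *)
move=> r0; pose ext (b : nat -> bool) k i :=
  if i == k then (g (mkseq b k) < 0)%R (+) sg else if (i < k)%N then b i else false.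
have extlt b k i : (i < k)%N -> ext b k i = b i.
  by move=> ik; rewrite /ext ltn_eqF// ik.
have extgt b k i : (k < i)%N -> ext b k i = false.
  by move=> ki; rewrite /ext gtn_eqF// ltnNge ltnW.
have sumext b k : digit_sum r g (ext b k) k.+1 =
    digit_sum r g b k + (-1) ^+ sg * (r ^+ k * `|g (mkseq b k)|).
  rewrite {1}/digit_sum big_ord_recr/= -/(digit_sum _ _ _ _).
  rewrite (eq_digit_sum _ _ (extlt b k)) (eq_mkseq_le (leqnn k) (extlt b k)).
  rewrite {1}/ext eqxx signr_addb [in RHS]normrEsign; congr (_ + _).
  by ring.
elim: m => [|m [b [bn bz IH]]].
  exists (ext b0 n); split; [exact: extlt| |].
    by move=> i; rewrite addn1; exact: extgt.
  by rewrite addn1 sumext addrAC subrr add0r signrMK.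
exists (ext b (n + m.+1)%N); split.
- by move=> i ni; rewrite extlt ?bn// ltn_addr.
- by move=> i; rewrite addnS; exact: extgt.
rewrite [(n + m.+2)%N]addnS sumext addrAC mulrDr signrMK (le_trans IH)// lerDl.
by rewrite mulr_ge0// exprn_ge0.
Qed.

(** * From partial sums to the uniform limit *)

Lemma uniform_cvg_near (R : realType) (f : nat -> R -> R) (F : R -> R) (e : R) :
  {uniform `[0, 1], f @ \oo --> F} -> 0 < e ->
  exists n0, forall n (t : R), (n0 <= n)%N -> t \in `[0, 1] -> `|F t - f n t| < e.
Proof.
move=> fF e0.
have /fF : nbhs (F : {uniform` `[0, 1] -> R})
    [set h | forall t, `[0, 1]%classic t -> `|F t - h t| < e].
  apply/uniform_nbhs; exists [set xy : R * R | `|xy.1 - xy.2| < e]; split => //.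
  rewrite -entourage_ballE; exists e => //.
move=> [n0 _ hn0]; exists n0 => n t n0n t01.
exact: hn0.
Qed.

Lemma powR_exprn (R : realType) (x y : R) (n : nat) : 0 <= x ->
  (x ^+ n) `^ y = (x `^ y) ^+ n.
Proof. by move=> x0; rewrite -!powR_mulrn ?powR_ge0// powRAC. Qed.

Lemma powR_lt1 (R : realType) (x y : R) : 0 <= x < 1 -> 0 < y -> x `^ y < 1.
Proof.
move=> /andP[x0 x1] y0; have := @gt0_ltr_powR R y y0 x 1.
by rewrite !nnegrE powR1; apply.
Qed.

(** A common prefix of length [j] bounds the difference of all partial sums by a multiple of
    [gamma ^+ j], which is the distance to the power [beta]; the bound survives the uniform
    limit. *)
Lemma holder_continuous_digit_sum (R : realType) (kappa beta r C : R)
    (g : seq bool -> R) (f : nat -> R -> R) (F : R -> R) :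
  0 < kappa < 1 -> 0 < beta -> 0 <= r -> 0 < C ->
  (forall n (t : R), t \in `[0, 1] -> f n t = digit_sum r g (binary_digits t) n) ->
  {uniform `[0, 1], f @ \oo --> F} ->
  (forall w, r ^+ size w * `|g w| <= C * (kappa `^ beta) ^+ size w) ->
  holder_continuous kappa beta F.
Proof.
move=> /andP[k0 k1] beta0 r0 C0 fE fF gC; set gamma := kappa `^ beta.
have gamma01 : 0 <= gamma < 1.
  by rewrite powR_ge0 powR_lt1// (ltW k0) k1.
have /andP[_ gamma1] := gamma01.
exists (2 * C / (1 - gamma)).
  by rewrite divr_gt0 ?mulr_gt0// subr_gt0.
move=> s t s01 t01; have [->|st] := eqVneq s t.
  rewrite subrr normr0 mulr_ge0 ?powR_ge0// divr_ge0 ?mulr_ge0// ltW//.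
  by rewrite subr_gt0.
have [j -> agree] := dkappa_neq kappa s01 t01 st.
rewrite (powR_exprn _ _ (ltW k0)) -/gamma; apply/ler_addgt0Pr => e e0.
have e20 : 0 < e / 2 by rewrite divr_gt0.
have [n hn] := uniform_cvg_near fF e20.
have hs := hn n s (leqnn n) s01; have ht := hn n t (leqnn n) t01.
have := digit_sum_diff_le n r0 gamma01 (ltW C0) gC agree.
rewrite -!fE//; move: hs ht; rewrite !ltr_norml !ler_norml.
move=> /andP[? ?] /andP[? ?] /andP[? ?]; apply/andP; split; lra.
Qed.

(** Two points near [t] are built greedily with increments of opposite signs; comparing them cancels
    the common sum over the first [n] digits and leaves an oscillation of at least 2 r^n |g|, up to
    the error of the limit. *)
Lemma pointwise_holder_small_path (R : realType) (kappa beta r : R)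
    (g : seq bool -> R) (f : nat -> R -> R) (F : R -> R) (t : R) :
  0 < kappa < 1 -> 0 < beta -> 0 <= r ->
  (forall n (t : R), t \in `[0, 1] -> f n t = digit_sum r g (binary_digits t) n) ->
  {uniform `[0, 1], f @ \oo --> F} ->
  t \in `[0, 1] -> pointwise_holder_at kappa beta F t ->
  exists M n0, forall n, (n0 <= n)%N ->
    r ^+ n * `|g (mkseq (binary_digits t) n)| <= M * (kappa `^ beta) ^+ n.
Proof.
move=> /andP[k0 k1] beta0 r0 fE fF t01 [M [eps [M0 eps0 hF]]].
have kcvg : (fun n => kappa ^+ n) @ \oo --> (0 : R).
  by apply: cvg_expr; rewrite ger0_norm// ltW.
have [n0 _ hn0] : \forall n \near \oo, kappa ^+ n < eps by exact: (cvgr_lt 0).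
(* [m] is fixed before the points are built, so that their partial sums at index [n + m.+1] are
   within [e] of the limit. *)
exists M, n0 => n /hn0 /= neps; set b0 := binary_digits t.
apply/ler_addgt0Pr => e e0; have [m hm] := uniform_cvg_near fF e0.
have near_t (s : R) : s \in `[0, 1] ->
    (forall i, (i < n)%N -> binary_digits s i = b0 i) ->
    `|F s - F t| <= M * (kappa `^ beta) ^+ n.
  move=> s01 sb0; have dn : dkappa kappa s t <= kappa ^+ n.
    by apply: dkappa_le => //; rewrite ltW//= ltW.
  apply: le_trans (hF _ s01 (le_lt_trans dn neps)) _.
  rewrite ler_wpM2l ?(ltW M0)// -(powR_exprn _ _ (ltW k0)).
  by apply: ge0_ler_powR; rewrite ?nnegrE ?dkappa_ge0 ?exprn_ge0// ltW.
have point (sg : bool) : exists2 s, s \in `[0, 1] &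
    `|F s - F t| <= M * (kappa `^ beta) ^+ n /\
    r ^+ n * `|g (mkseq b0 n)| <=
      (-1) ^+ sg * (f (n + m.+1)%N s - digit_sum r g b0 n).
  have [b [bn bz hb]] := greedy_digits g b0 sg n m r0.
  have [s s01 sb] := binary_digits_finite_surj R bz.
  exists s => //; split; first by apply: near_t => // i; rewrite sb; exact: bn.
  by rewrite fE// sb.
have [s s01 [Fs hs]] := point false; have [s' s'01 [Fs' hs']] := point true.
have mnm : (m <= n + m.+1)%N by rewrite addnS leqW// leq_addl.
have us := hm _ s mnm s01; have us' := hm _ s' mnm s'01.
move: hs hs' Fs Fs' us us'; rewrite expr0 expr1 mul1r mulN1r.
rewrite !ltr_norml !ler_norml => ? ? /andP[? ?] /andP[? ?] /andP[? ?] /andP[? ?].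
lra.
Qed.

(** * The two ranges of [beta] for the limit process *)

Theorem theorem4p7 (R : realType) (d : measure_display) (T : measurableType d)
    (P : probability T R) (alpha kappa : R)
    (N : seq bool -> {RV P >-> R}) (Z : T -> R -> R)
    (halpha : 0 < alpha <= 2^-1) (hkappa : kappa = 2^-1 `^ (2 - alpha))
    (hnormal : forall w, standard_normal (N w))
    (hindep : independent_RVs N)
    (hZ : is_limit_process alpha N Z) :
  (forall beta : R, 0 < beta < 2^-1 ->
     {ae P, forall omega, holder_continuous kappa beta (Z omega)}) /\
  (forall beta : R, 2^-1 < beta ->
     {ae P, forall omega, nowhere_pointwise_holder kappa beta (Z omega)}).
Proof.
set r : R := 2^-1 `^ (1 - alpha / 2).
have k01 : 0 < kappa < 1.
  rewrite hkappa powR_gt0 ?invr_gt0//= powR_lt1//; last by lra.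
  by rewrite invr_ge0 ler0n invf_lt1// ltr1n.
have /andP[k0 k1] := k01.
(* The weight is the square root of [kappa], as [1 - alpha / 2] is half of [2 - alpha]. *)
have rE : r = kappa `^ 2^-1.
  by rewrite hkappa -powRrM /r; congr (_ `^ _); lra.
have r0 : 0 < r by rewrite rE powR_gt0.
have ZE omega n t := @ZnE _ _ _ _ alpha N n omega t.
split=> [beta /andP[beta0 beta2]|beta beta2].
  (* The exponent is negative, so [rho] exceeds 1, and [r * rho] is [kappa] to the power [beta], the
     ratio that the Hölder bound requires. *)
  pose rho := kappa `^ (beta - 2^-1).
  have rho1 : 1 < rho.
    rewrite /rho -opprB powRN invf_gt1 ?powR_gt0// powR_lt1 ?subr_gt0//.
    by rewrite ltW.
  have := ae_words_growth hnormal rho1; move: hZ; apply: filterS2.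
  move=> omega cvgZ [C C0 hC].
  apply: (holder_continuous_digit_sum k01 beta0 (ltW r0) C0 (ZE omega) cvgZ).
  move=> w; have -> : kappa `^ beta = r * rho.
    by rewrite rE /rho -powRD ?gt_eqF ?implybT// addrC subrK.
  by rewrite exprMn mulrCA ler_wpM2l// exprn_ge0// ltW.
have := ae_no_small_path hnormal hindep; move: hZ; apply: filterS2.
move=> omega cvgZ nosmall t t01 hol; have beta0 : 0 < beta by lra.
have [M [n0 hn0]] := pointwise_holder_small_path k01 beta0 (ltW r0) (ZE omega)
  cvgZ t01 hol.
(* Now the exponent is positive, so [q < 1]; cancelling [r ^+ n] in the path bound leaves |N| <= M
   q^n along the digits of [t]. *)
pose q := kappa `^ (beta - 2^-1).
have q01 : 0 <= q < 1 by rewrite powR_ge0 powR_lt1 ?subr_gt0// ltW.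
have /andP[q0 q1] := q01.
have qcvg : (fun n => M * q ^+ n) @ \oo --> (0 : R).
  rewrite -[X in _ --> X](mulr0 M); apply: cvgMr.
  by apply: cvg_expr; rewrite ger0_norm.
have [n1 _ hn1] : \forall n \near \oo, M * q ^+ n < 4^-1.
  by apply: (cvgr_lt 0 qcvg); rewrite invr_gt0.
have [n] := nosmall (maxn n0 n1) (binary_digits t).
rewrite geq_max => /andP[n0n n1n]; apply/negP; rewrite -leNgt.
apply: le_trans (ltW (hn1 n n1n)).
have := hn0 n n0n; have -> : kappa `^ beta = r * q.
  by rewrite rE /q -powRD ?gt_eqF ?implybT// addrC subrK.
by rewrite exprMn mulrCA ler_pM2l// exprn_gt0.
Qed.
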